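(* Let $\mathbf{A}$ be an abelian category, let $\mathcal{O}$ be a class of objects of $\mathbf{A}$ (containing $0$ and closed under isomorphism), and let $w$ be a weight on $\mathcal{O}$. Assume that for every short exact sequence $0 \to A \to B \to C \to 0$ in $\mathbf{A}$ in which two of $A,B,C$ are in $\mathcal{O}$, so is the third. Then the following three conditions on $w$ are equivalent: (1) $w$ is exact; (2) $w$ is stable; (3) $w$ lower bounds its path metric.
   Context: A weight on $\mathcal{O}$ is an assignment of $w(A)\in[0,\infty]$ to each $A\in\mathcal{O}$ such that $w(0)=0$ and $w(A)=w(B)$ whenever $A\cong B$. Path metric $d_w$: let $\mathcal{M}$ be the class of morphisms $f$ in $\mathbf{A}$ such that both $\ker f$ and $\operatorname{coker} f$ are in $\mathcal{O}$, and put $w(f)=w(\ker f)+w(\operatorname{coker} f)$ for $f\in\mathcal{M}$. A zigzag from $A$ to $B$ is a finite sequence of morphisms joining $A=A_0,A_1,\dots,A_n=B$ ($n\ge 0$), the $i$-th one being a morphism between $A_{i-1}$ and $A_i$ in either direction. The cost of a zigzag all of whose morphisms are in $\mathcal{M}$ is the sum of the weights of its morphisms (and $0$ if $n=0$). For $A,B\in\mathbf{A}$, $d_w(A,B)\in[0,\infty]$ is the infimum of the costs of all zigzags from $A$ to $B$ whose morphisms all lie in $\mathcal{M}$ ($d_w(A,B)=\infty$ if there are none). $w$ is exact if for each short exact sequence $0\to A\to B\to C\to 0$ in $\mathbf{A}$ with $A,B,C\in\mathcal{O}$, one has $w(A)\le w(B)+w(C)$, $w(B)\le w(A)+w(C)$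 and $w(C)\le w(A)+w(B)$. $w$ is stable if $d_w(A,0)=w(A)$ for all $A\in\mathcal{O}$. $w$ lower bounds its path metric if $|w(A)-w(B)|\le d_w(A,B)$ for all $A,B\in\mathcal{O}$, where $|w(A)-w(B)|$ is read as $0$ if $w(A)=w(B)=\infty$. *)

(* Defs.v *)
From HB Require Import structures.
From mathcomp Require Import all_boot all_order all_algebra.
From mathcomp Require Import all_classical all_reals ereal.

Set Implicit Arguments.
Unset Strict Implicit.
Unset Printing Implicit Defensive.

Import GRing.Theory.
Local Open Scope classical_set_scope.
Local Open Scope ring_scope.

(* An Ab-category.  Typing the hom-groups as zmodTypes is no restriction: by
   boolp every type is classically a choiceType. *)
Record preadditive_category := PreadditiveCategory {
  obj :> Type;
  hom : obj -> obj -> zmodType;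
  idm : forall A, hom A A;
  comp : forall A B C, hom B C -> hom A B -> hom A C;
  comp_idl : forall A B (f : hom A B), comp (idm B) f = f;
  comp_idr : forall A B (f : hom A B), comp f (idm A) = f;
  compA : forall A B C D (h : hom C D) (g : hom B C) (f : hom A B),
    comp h (comp g f) = comp (comp h g) f;
  compDl : forall A B C (g g' : hom B C) (f : hom A B),
    comp (g + g') f = comp g f + comp g' f;
  compDr : forall A B C (g : hom B C) (f f' : hom A B),
    comp g (f + f') = comp g f + comp g f'
}.

Arguments idm {p} A.

Section Preadditive.
Variable C : preadditive_category.
Implicit Types A B K P Q X Z : C.

Definition mono A B (f : hom A B) : Prop :=
  forall Z (g h : hom Z A), comp f g = comp f h -> g = h.

Definition epi A B (f : hom A B) : Prop :=
  forall Z (g h : hom B Z), comp g f = comp h f -> g = h.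

Definition isomorphic A B : Prop :=
  exists (f : hom A B) (g : hom B A), comp g f = idm A /\ comp f g = idm B.

Definition is_zero_object Z : Prop :=
  forall A, (exists! f : hom A Z, True) /\ (exists! f : hom Z A, True).

Definition is_kernel A B (f : hom A B) K (k : hom K A) : Prop :=
  comp f k = 0 /\
  forall Z (g : hom Z A), comp f g = 0 -> exists! h : hom Z K, comp k h = g.

Definition is_cokernel A B (f : hom A B) Q (q : hom B Q) : Prop :=
  comp q f = 0 /\
  forall Z (g : hom B Z), comp g f = 0 -> exists! h : hom Q Z, comp h q = g.

(* These equations imply comp p1 i2 = 0 and comp p2 i1 = 0. *)
Definition is_biproduct A B P (i1 : hom A P) (i2 : hom B P)
    (p1 : hom P A) (p2 : hom P B) : Prop :=
  [/\ comp p1 i1 = idm A, comp p2 i2 = idm B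
    & comp i1 p1 + comp i2 p2 = idm P].

End Preadditive.

(* Mac Lane's definition. *)
Record abelian_category := AbelianCategory {
  preadditive_of :> preadditive_category;
  has_zero_object : exists Z : preadditive_of, is_zero_object Z;
  has_biproducts : forall A B : preadditive_of,
    exists (P : preadditive_of) (i1 : hom A P) (i2 : hom B P)
           (p1 : hom P A) (p2 : hom P B), is_biproduct i1 i2 p1 p2;
  has_kernels : forall (A B : preadditive_of) (f : hom A B),
    exists (K : preadditive_of) (k : hom K A), is_kernel f k;
  has_cokernels : forall (A B : preadditive_of) (f : hom A B),
    exists (Q : preadditive_of) (q : hom B Q), is_cokernel f q;
  mono_is_kernel : forall (A B : preadditive_of) (f : hom A B), mono f ->
    exists (X : preadditive_of) (g : hom B X), is_kernel g f;
  epi_is_cokernel : forall (A B : preadditive_of) (f : hom A B), epi f ->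
    exists (X : preadditive_of) (g : hom X A), is_cokernel g f
}.

Section Abelian.
Variable C : abelian_category.
Implicit Types A B X : C.

Definition zero_object : C := sval (cid (has_zero_object C)).

Definition ker A B (f : hom A B) : C := sval (cid (has_kernels f)).

Definition ker_map A B (f : hom A B) : hom (ker f) A :=
  sval (cid (svalP (cid (has_kernels f)))).

Definition coker A B (f : hom A B) : C := sval (cid (has_cokernels f)).

Definition coker_map A B (f : hom A B) : hom B (coker f) :=
  sval (cid (svalP (cid (has_cokernels f)))).

Definition im_map A B (f : hom A B) : hom (ker (coker_map f)) B :=
  ker_map (coker_map f).

(* The image of f is the kernel of g. *)
Definition exact_at A B X (f : hom A B) (g : hom B X) : Prop :=
  is_kernel g (im_map f).

Definition short_exact A B X (f : hom A B) (g : hom B X) : Prop :=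
  [/\ mono f, exact_at f g & epi g].

Inductive zigzag A : C -> Type :=
| zz_nil : zigzag A A
| zz_fwd B X : zigzag A B -> hom B X -> zigzag A X
| zz_bwd B X : zigzag A B -> hom X B -> zigzag A X.

End Abelian.

Arguments zero_object C : clear implicits.

Section Weights.
Variables (R : realType) (C : abelian_category) (O : set C).

Definition iso_closed : Prop :=
  forall A B : C, isomorphic A B -> O A -> O B.

Definition two_out_of_three : Prop :=
  forall (A B X : C) (f : hom A B) (g : hom B X), short_exact f g ->
  [/\ O A -> O B -> O X, O A -> O X -> O B & O B -> O X -> O A].

(* A weight on O is represented by a function on all objects, whose values
   outside O are arbitrary and never used. *)
Variable w : C -> \bar R.

Local Open Scope ereal_scope.

Record is_weight : Prop := IsWeight {
  weight_ge0 : forall A, O A -> 0 <= w A;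
  weight0 : w (zero_object C) = 0;
  weight_iso : forall A B : C, O A -> O B -> isomorphic A B -> w A = w B
}.

Definition in_M (A B : C) (f : hom A B) : Prop := O (ker f) /\ O (coker f).

Definition mor_weight (A B : C) (f : hom A B) : \bar R :=
  w (ker f) + w (coker f).

Fixpoint zigzag_in_M (A B : C) (z : zigzag A B) : Prop :=
  match z with
  | zz_nil => True
  | zz_fwd _ _ z' f => zigzag_in_M z' /\ in_M f
  | zz_bwd _ _ z' f => zigzag_in_M z' /\ in_M f
  end.

Fixpoint zigzag_cost (A B : C) (z : zigzag A B) : \bar R :=
  match z with
  | zz_nil => 0
  | zz_fwd _ _ z' f => zigzag_cost z' + mor_weight f
  | zz_bwd _ _ z' f => zigzag_cost z' + mor_weight f
  end.

(* ereal_inf set0 = +oo *)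
Definition path_metric (A B : C) : \bar R :=
  ereal_inf [set zigzag_cost z | z in [set z : zigzag A B | zigzag_in_M z]].

Definition weight_exact : Prop :=
  forall (A B X : C) (f : hom A B) (g : hom B X), short_exact f g ->
  O A -> O B -> O X ->
  [/\ w A <= w B + w X, w B <= w A + w X & w X <= w A + w B].

Definition weight_stable : Prop :=
  forall A : C, O A -> path_metric A (zero_object C) = w A.

(* The library has +oo - +oo = -oo, hence the case distinction. *)
Definition weight_dist (x y : \bar R) : \bar R :=
  if (x == +oo) && (y == +oo) then 0 else `|x - y|.

Definition lower_bounds_path_metric : Prop :=
  forall A B : C, O A -> O B -> weight_dist (w A) (w B) <= path_metric A B.

End Weights.

(* Main.v *)
Require Import Defs.
From HB Require Import structures.
From mathcomp Require Import all_boot all_order all_algebra.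
From mathcomp Require Import all_classical all_reals ereal.

(** If [w] is exact, then for [f : A -> B] in M the exact sequences
    [0 -> ker f -> A -> im f -> 0] and [0 -> im f -> B -> coker f -> 0] show
    that [A] is in [O] iff [B] is, and that [w A] and [w B] differ by at most
    [w f]; summing along a zigzag, [w] lower bounds its path metric.  If it does,
    then [w A <= d_w (A, 0)], and the zigzag [A -> 0] gives the converse
    inequality.  If finally [w] is stable, the three inequalities for
    [0 -> A -> B -> X -> 0] follow from the zigzags [A -> B -> 0],
    [B <- A -> 0] and [X <- B -> 0]. *)

(* [Defs] is imported again because MathComp's [vector] shadows [hom]. *)
Import Order.TTheory GRing.Theory Num.Theory Defs.

(** * Kernels and cokernels in a preadditive category *)

Section Preadditive.
Local Set Implicit Arguments.
Local Unset Strict Implicit.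
Local Open Scope ring_scope.
Context {C : preadditive_category}.
Implicit Types A B K Q X Z : C.

Lemma comp0r A B X (g : hom B X) : comp g (0 : hom A B) = 0.
Proof. by apply: (addrI (comp g 0)); rewrite -compDr !addr0. Qed.

Lemma comp0l A B X (f : hom A B) : comp (0 : hom B X) f = 0.
Proof. by apply: (addrI (comp 0 f)); rewrite -compDl !addr0. Qed.

Lemma compBl A B X (g h : hom B X) (f : hom A B) :
  comp (g - h) f = comp g f - comp h f.
Proof. by apply/eqP; rewrite eq_sym subr_eq -compDl subrK. Qed.

(** Trades uniqueness of the factorization for [mono k], which can be cancelled directly. *)
Lemma is_kernelP A B K (f : hom A B) (k : hom K A) :
  is_kernel f k <->
  [/\ mono k, comp f k = 0 &
      forall Z (g : hom Z A), comp f g = 0 -> exists h, comp k h = g].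
Proof.
split=> [[fk0 Uk]|[mk fk0 Uk]]; split=> //.
- move=> Z g h kgh; have [|u [_ uniq_u]] := Uk Z (comp k g).
    by rewrite compA fk0 comp0l.
  by rewrite -(uniq_u g erefl) (uniq_u h).
- by move=> Z g /Uk[h [kh _]]; exists h.
- move=> Z g /Uk[h kh]; exists h; split=> // h' kh'.
  by apply: mk; rewrite kh kh'.
Qed.

Lemma is_cokernelP A B Q (f : hom A B) (q : hom B Q) :
  is_cokernel f q <->
  [/\ epi q, comp q f = 0 &
      forall Z (g : hom B Z), comp g f = 0 -> exists h, comp h q = g].
Proof.
split=> [[qf0 Uq]|[eq qf0 Uq]]; split=> //.
- move=> Z g h gqh; have [|u [_ uniq_u]] := Uq Z (comp g q).
    by rewrite -compA qf0 comp0r.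
  by rewrite -(uniq_u g erefl) (uniq_u h).
- by move=> Z g /Uq[h [hq _]]; exists h.
- move=> Z g /Uq[h hq]; exists h; split=> // h' hq'.
  by apply: eq; rewrite hq hq'.
Qed.

Lemma kernel_isomorphic A B K K' (f : hom A B) (k : hom K A) (k' : hom K' A) :
  is_kernel f k -> is_kernel f k' -> isomorphic K K'.
Proof.
move=> /is_kernelP[mk fk Uk] /is_kernelP[mk' fk' Uk'].
have [u ku] := Uk' _ _ fk; have [v kv] := Uk _ _ fk'.
exists u, v; split; [apply: mk | apply: mk'].
  by rewrite compA kv ku comp_idr.
by rewrite compA ku kv comp_idr.
Qed.

Lemma cokernel_isomorphic A B Q Q' (f : hom A B)
    (q : hom B Q) (q' : hom B Q') :
  is_cokernel f q -> is_cokernel f q' -> isomorphic Q Q'.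
Proof.
move=> /is_cokernelP[eq qf Uq] /is_cokernelP[eq' qf' Uq'].
have [u uq] := Uq _ _ qf'; have [v vq] := Uq' _ _ qf.
exists u, v; split; [apply: eq | apply: eq'].
  by rewrite -compA uq vq comp_idl.
by rewrite -compA vq uq comp_idl.
Qed.

(** Since [f] factors through [q], whatever [q] kills is killed by [f] and so factors through
    [k]. *)
Lemma kernel_of_cokernel A B K Q (f : hom A B) (k : hom K A) (q : hom A Q) :
  is_kernel f k -> is_cokernel k q -> is_kernel q k.
Proof.
move=> /is_kernelP[mk fk Uk] /is_cokernelP[eq qk Uq].
apply/is_kernelP; split=> // Z g qg; apply: Uk.
by have [u <-] := Uq _ _ fk; rewrite -compA qg comp0r.
Qed.

Lemma cokernel_of_kernel A B K Q (f : hom A B) (k : hom K B) (q : hom B Q) :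
  is_cokernel f q -> is_kernel q k -> is_cokernel k q.
Proof.
move=> /is_cokernelP[eq qf Uq] /is_kernelP[mk qk Uk].
apply/is_cokernelP; split=> // Z g gk; apply: Uq.
by have [u <-] := Uk _ _ qf; rewrite compA gk comp0l.
Qed.

Lemma kernel_of_mono A B Z (f : hom A B) :
  is_zero_object Z -> mono f -> is_kernel f (0 : hom Z A).
Proof.
move=> Z0 mf; apply/is_kernelP; split; rewrite ?comp0r//.
- move=> Y g h _; have [[u [_ uniq_u]] _] := Z0 Y.
  by rewrite -(uniq_u g) // (uniq_u h).
- by move=> Y g fg; exists 0; apply: mf; rewrite comp0r comp0r fg.
Qed.

Lemma cokernel_of_epi A B Z (f : hom A B) :
  is_zero_object Z -> epi f -> is_cokernel f (0 : hom B Z).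
Proof.
move=> Z0 ef; apply/is_cokernelP; split; rewrite ?comp0l//.
- move=> Y g h _; have [_ [u [_ uniq_u]]] := Z0 Y.
  by rewrite -(uniq_u g) // (uniq_u h).
- by move=> Y g gf; exists 0; apply: ef; rewrite comp0l comp0l gf.
Qed.

Lemma kernel_of_zero A B : is_kernel (0 : hom A B) (idm A).
Proof.
apply/is_kernelP; split; rewrite ?comp0l//.
  by move=> Z g h; rewrite !comp_idl.
by move=> Z g _; exists g; rewrite comp_idl.
Qed.

Lemma epi_to_zero A Z : is_zero_object Z -> epi (0 : hom A Z).
Proof.
move=> Z0 Y g h _; have [_ [u [_ uniq_u]]] := Z0 Y.
by rewrite -(uniq_u g) // (uniq_u h).
Qed.

End Preadditive.

(** * Short exact sequences and the image factorization *)

Section Abelian.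
Local Set Implicit Arguments.
Local Unset Strict Implicit.
Local Open Scope ring_scope.
Context {C : abelian_category}.
Implicit Types A B X : C.

Lemma zero_objectP : is_zero_object (zero_object C).
Proof. exact: (svalP (cid (has_zero_object C))). Qed.

Lemma ker_mapP A B (f : hom A B) : is_kernel f (ker_map f).
Proof. exact: (svalP (cid (svalP (cid (has_kernels f))))). Qed.

Lemma coker_mapP A B (f : hom A B) : is_cokernel f (coker_map f).
Proof. exact: (svalP (cid (svalP (cid (has_cokernels f))))). Qed.

(** A kernel is the kernel of its own cokernel, so [f] and [im_map f] factor through each other. *)
Lemma exact_at_kernel A B X (f : hom A B) (g : hom B X) :
  is_kernel g f -> exact_at f g.
Proof.
move=> gf.
have /is_kernelP[_ gf0 Ug] := gf.
have /is_kernelP[_ _ Uf] := kernel_of_cokernel gf (coker_mapP f).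
have /is_cokernelP[_ qf _] := coker_mapP f.
have /is_kernelP[mm qm Um] := ker_mapP (coker_map f).
have [u fu] := Uf _ _ qm.
apply/is_kernelP; split=> //.
  by rewrite /im_map -fu compA gf0 comp0l.
by move=> Z x /Ug[y <-]; apply: Um; rewrite compA qf comp0l.
Qed.

(** The mono [f] is the kernel of some map, hence of its own cokernel; it therefore agrees with
    [im_map f] up to isomorphism. *)
Lemma short_exact_kernel A B X (f : hom A B) (g : hom B X) :
  short_exact f g -> is_kernel g f.
Proof.
case=> mf /is_kernelP[mm gm Um] _.
have [Y [h hf]] := mono_is_kernel mf.
have /is_kernelP[_ qf Uf] := kernel_of_cokernel hf (coker_mapP f).
have /is_kernelP[_ qm Uq] := ker_mapP (coker_map f).
have [e me] := Uq _ _ qf; have [t ft] := Uf _ _ qm.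
apply/is_kernelP; split=> //.
  by rewrite -me compA gm comp0l.
by move=> Z x /Um[y <-]; exists (comp t y); rewrite compA ft.
Qed.

Lemma short_exact_cokernel A B X (f : hom A B) (g : hom B X) :
  short_exact f g -> is_cokernel f g.
Proof.
move=> fg; have [_ _ eg] := fg.
have [Y [h hg]] := epi_is_cokernel eg.
exact: cokernel_of_kernel hg (short_exact_kernel fg).
Qed.

Lemma im_short_exact A B (f : hom A B) :
  short_exact (im_map f) (coker_map f).
Proof.
have /is_kernelP[mm _ _] := ker_mapP (coker_map f).
have /is_cokernelP[eq _ _] := coker_mapP f.
by split=> //; apply/exact_at_kernel/ker_mapP.
Qed.

(** The witness is the corestriction of [f] to its image. It has the same kernel as [f] because
    [im_map f] is mono; the work lies in showing that it is epi. *)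
Lemma coim_short_exact A B (f : hom A B) :
  exists e : hom A (ker (coker_map f)), short_exact (ker_map f) e.
Proof.
have /is_kernelP[mm qm Um] := ker_mapP (coker_map f).
have /is_cokernelP[_ qf Uq] := coker_mapP f.
have /is_kernelP[mk fk Uk] := ker_mapP f.
have [e me] := Um _ _ qf.
exists e; split=> //.
  apply/exact_at_kernel/is_kernelP; split=> //.
    by apply: mm; rewrite compA me fk comp0r.
  by move=> Z x ex; apply: Uk; rewrite -me -compA ex comp0r.
(* The kernel [l] of the difference of two maps equalized by [e] is a subobject
   of [im f] through which [f] factors; being a kernel in [B], it is all of
   [im f]. *)
move=> Z g h geh.
have /is_kernelP[ml dl Ul] := ker_mapP (g - h).
have [|e' le] := Ul _ e; first by rewrite compBl geh subrr.
have mml : mono (comp (ker_map (coker_map f)) (ker_map (g - h))).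
  by move=> Y x y; rewrite -!compA => /mm/ml.
have [Y [p /is_kernelP[_ pml Up]]] := mono_is_kernel mml.
(* As [p] kills the smaller subobject, it kills [f], so it factors through [coker_map f] and kills
   the whole image. *)
have [|p' pq] := Uq _ p.
  by rewrite -me -le !compA -(compA p) pml comp0l.
have [|t mlt] := Up _ (ker_map (coker_map f)).
  by rewrite -pq -compA qm comp0r.
have lt : comp (ker_map (g - h)) t = idm _.
  by apply: mm; rewrite compA mlt comp_idr.
by apply/eqP; rewrite -subr_eq0 -(comp_idr (g - h)) -lt compA dl comp0l.
Qed.

End Abelian.

(** * Weights of morphisms and costs of zigzags *)

Section Weights.
Local Set Implicit Arguments.
Local Unset Strict Implicit.
Local Open Scope ereal_scope.
Context {R : realType} {C : abelian_category} {O : set C} {w : C -> \bar R}.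
Hypotheses (O_zero : O (zero_object C)) (O_iso : iso_closed O).
Hypothesis w_weight : is_weight O w.
Implicit Types A B X : C.

Lemma weight_transport A B :
  isomorphic A B -> O A -> O B /\ w B = w A.
Proof.
move=> AB OA; have OB := O_iso AB OA.
by rewrite (weight_iso w_weight OA OB AB).
Qed.

Lemma mor_weight_ge0 A B (f : hom A B) : in_M O f -> 0 <= mor_weight w f.
Proof. by case=> ? ?; rewrite adde_ge0 ?(weight_ge0 w_weight). Qed.

Lemma zigzag_cost_ge0 A B (z : zigzag A B) :
  zigzag_in_M O z -> 0 <= zigzag_cost w z.
Proof.
by elim: z => //= ? ? z IH f [/IH ? /mor_weight_ge0 ?]; rewrite adde_ge0.
Qed.

Lemma mor_weight_mono A B X (f : hom A B) (g : hom B X) :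
  short_exact f g -> O X -> in_M O f /\ mor_weight w f = w X.
Proof.
move=> fg OX; have [mf _ _] := fg.
have [Ok wk] := weight_transport
  (kernel_isomorphic (kernel_of_mono zero_objectP mf) (ker_mapP f)) O_zero.
have [Oc wc] := weight_transport
  (cokernel_isomorphic (short_exact_cokernel fg) (coker_mapP f)) OX.
by rewrite /mor_weight wk wc (weight0 w_weight) add0e.
Qed.

(** Stated for an arbitrary kernel, so that it applies both to the epi of a short exact sequence and
    to [A -> 0], whose kernel is the identity. *)
Lemma mor_weight_epi A B K (k : hom K A) (f : hom A B) :
  is_kernel f k -> epi f -> O K -> in_M O f /\ mor_weight w f = w K.
Proof.
move=> fk ef OK.
have [Ok wk] := weight_transport (kernel_isomorphic fk (ker_mapP f)) OK.
have [Oc wc] := weight_transport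
  (cokernel_isomorphic (cokernel_of_epi zero_objectP ef) (coker_mapP f)) O_zero.
by rewrite /mor_weight wk wc (weight0 w_weight) adde0.
Qed.

Lemma mor_weight_to_zero A :
  O A -> in_M O (0%R : hom A (zero_object C)) /\
         mor_weight w (0%R : hom A (zero_object C)) = w A.
Proof.
move=> OA; apply: mor_weight_epi OA; first exact: kernel_of_zero.
exact: epi_to_zero zero_objectP.
Qed.

Lemma path_metric_le A B (z : zigzag A B) :
  zigzag_in_M O z -> path_metric O w A B <= zigzag_cost w z.
Proof. by move=> Mz; apply: ereal_inf_lbound; exists z. Qed.

Lemma exact_of_stable : weight_stable O w -> weight_exact O w.
Proof.
move=> st A B X f g fg OA OB OX; have [_ _ eg] := fg.
have [Mf wf] := mor_weight_mono fg OX.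
have [Mg wg] := mor_weight_epi (short_exact_kernel fg) eg OA.
have [MA wA] := mor_weight_to_zero OA.
have [MB wB] := mor_weight_to_zero OB.
split.
(* In each case the left-hand weight becomes a distance to zero by stability, and the right-hand
   weights become those of the arrows of one zigzag. *)
- rewrite -{1}(st A OA) addeC -wf -wB.
  have := path_metric_le (z := zz_fwd (zz_fwd (zz_nil A) f) (0%R : hom B (zero_object C))).
  by rewrite /= add0e; apply.
- rewrite -{1}(st B OB) addeC -wf -wA.
  have := path_metric_le (z := zz_fwd (zz_bwd (zz_nil B) f) (0%R : hom A (zero_object C))).
  by rewrite /= add0e; apply.
- rewrite -{1}(st X OX) -wg -wB.
  have := path_metric_le (z := zz_fwd (zz_bwd (zz_nil X) g) (0%R : hom B (zero_object C))).
  by rewrite /= add0e; apply.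
Qed.

Lemma stable_of_lower_bounds :
  lower_bounds_path_metric O w -> weight_stable O w.
Proof.
move=> lb A OA; apply/eqP; rewrite eq_le; apply/andP; split.
  have [MA wA] := mor_weight_to_zero OA.
  rewrite -[leRHS]wA.
  have := path_metric_le (z := zz_fwd (zz_nil A) (0%R : hom A (zero_object C))).
  by rewrite /= add0e; apply.
have := lb A _ OA O_zero.
(* The zero object has finite weight, which rules out the special case of [weight_dist]. *)
rewrite /weight_dist (weight0 w_weight) andbF sube0 gee0_abs //.
exact: weight_ge0 w_weight _ OA.
Qed.

(** For finite [c] the two inequalities force [x] and [y] to be infinite together, and then the
    distance is [0] by convention. *)
Lemma weight_dist_le (x y c : \bar R) :
  0 <= x -> 0 <= y -> 0 <= c -> x <= y + c -> y <= x + c ->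
  weight_dist x y <= c.
Proof.
rewrite /weight_dist.
case: x y c => [x| |] [y| |] [c| |] //=; rewrite ?leey // -?EFinD !lee_fin.
by move=> _ _ _ xyc yxc; rewrite ler_distl lerBlDr yxc.
Qed.

Hypothesis O_two_out_of_three : two_out_of_three O.

(** Propagates membership in [O] along zigzags, so that exactness can be used at every arrow. *)
Lemma in_M_mem_iff A B (f : hom A B) : in_M O f -> O A <-> O B.
Proof.
case=> Ok Oc; have [e se] := coim_short_exact f.
have [kAI kIA _] := O_two_out_of_three se.
have [_ IcB BcI] := O_two_out_of_three (im_short_exact f).
split=> [OA|OB]; first by apply: IcB => //; apply: kAI.
by apply: kIA => //; apply: BcI.
Qed.

(** Both bounds pass through the image of [f], which lies in [O]: its weight is within [w (ker f)]
    of [w A] and within [w (coker f)] of [w B]. *)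
Lemma mor_weight_exact A B (f : hom A B) :
  weight_exact O w -> in_M O f -> O A -> O B ->
  w A <= w B + mor_weight w f /\ w B <= w A + mor_weight w f.
Proof.
move=> ex Mf OA OB; have [Ok Oc] := Mf; have [e se] := coim_short_exact f.
have [kAI _ _] := O_two_out_of_three se; have OI := kAI Ok OA.
have [_ A1 A2] := ex _ _ _ _ _ se Ok OA OI.
have [B1 B2 _] := ex _ _ _ _ _ (im_short_exact f) OI OB Oc.
rewrite /mor_weight; split.
  by rewrite addeCA (le_trans A1)// leeD2l.
by rewrite addeA [w A + _]addeC (le_trans B2)// leeD2r.
Qed.

(** Membership of the endpoint is part of the conclusion because the induction needs it for the
    intermediate objects. *)
Lemma zigzag_cost_exact A B (z : zigzag A B) :
  weight_exact O w -> O A -> zigzag_in_M O z ->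
  [/\ O B, w A <= w B + zigzag_cost w z & w B <= w A + zigzag_cost w z].
Proof.
move=> ex OA; elim: z => [|B' X z IH f|B' X z IH f] /=.
- by rewrite adde0.
- case=> /IH[OB' AB BA] Mf; have OX := (in_M_mem_iff Mf).1 OB'.
  have [B'X XB'] := mor_weight_exact ex Mf OB' OX; split=> //.
    by rewrite [X in _ + X]addeC addeA (le_trans AB)// leeD2r.
  by rewrite addeA (le_trans XB')// leeD2r.
- case=> /IH[OB' AB BA] Mf; have OX := (in_M_mem_iff Mf).2 OB'.
  have [XB' B'X] := mor_weight_exact ex Mf OX OB'; split=> //.
    by rewrite [X in _ + X]addeC addeA (le_trans AB)// leeD2r.
  by rewrite addeA (le_trans XB')// leeD2r.
Qed.

Lemma lower_bounds_of_exact :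
  weight_exact O w -> lower_bounds_path_metric O w.
Proof.
(* It suffices to bound the cost of each zigzag in M from below. *)
move=> ex A B OA OB; apply: le_ereal_inf_tmp => _ [z Mz <-].
have [_ AB BA] := zigzag_cost_exact ex OA Mz.
apply: weight_dist_le => //; last exact: zigzag_cost_ge0.
  exact: weight_ge0 w_weight _ OA.
exact: weight_ge0 w_weight _ OB.
Qed.

End Weights.

Theorem theorem1p1 (R : realType) (C : abelian_category) (O : set C)
    (w : C -> \bar R)
    (O_zero : O (zero_object C)) (O_iso : iso_closed O)
    (w_weight : is_weight O w) (O_two_out_of_three : two_out_of_three O) :
  (weight_exact O w <-> weight_stable O w) /\
  (weight_stable O w <-> lower_bounds_path_metric O w) /\
  (lower_bounds_path_metric O w <-> weight_exact O w).
Proof.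
have st_ex := exact_of_stable O_zero O_iso w_weight.
have lb_st := stable_of_lower_bounds O_zero O_iso w_weight.
have ex_lb := lower_bounds_of_exact w_weight O_two_out_of_three.
tauto.
Qed.
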